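(* Assume that $n \geq k + 2$, $|A| = k$, and $f \colon A^n \to B$ is determined by $(\operatorname{pr}, \operatorname{supp})$. Then $f$ is reconstructible.
   Context: $A$ and $B$ are sets with at least two elements; $k$, $n$ are positive integers. $[n] := \{1,\dots,n\}$, $\binom{[n]}{2}$ denotes the set of all $2$-element subsets of $[n]$, and $\Sigma_n$ is the symmetric group on $[n]$. For $\mathbf{a} \in A^n$ and $\sigma \colon [m] \to [n]$, write $\mathbf{a}\sigma := (a_{\sigma(1)},\dots,a_{\sigma(m)}) \in A^m$. Functions $f, g \colon A^n \to B$ are equivalent, $f \equiv g$, if there is $\sigma \in \Sigma_n$ with $f(\mathbf{a}) = g(\mathbf{a}\sigma)$ for all $\mathbf{a} \in A^n$. For $n \geq 2$, $f \colon A^n \to B$ and $I \in \binom{[n]}{2}$, the identification minor $f_I \colon A^{n-1} \to B$ is given by $f_I(\mathbf{a}) = f(\mathbf{a}\delta_I)$, where $\delta_I \colon [n] \to [n-1]$ is defined by $\delta_I(i) = i$ if $i < \max I$, $\delta_I(i) = \min I$ if $i = \max I$, and $\delta_I(i) = i-1$ if $i > \max I$. The deck of $f$, $\operatorname{deck} f$, is the multiset $\{f_I/{\equiv} : I \in \binom{[n]}{2}\}$ of equivalence classes. A function $g \colon A^n \to B$ is a reconstruction of $f$ if $\operatorname{deck} f = \operatorname{deck} g$. The function $f$ is reconstructible if it is equivalent to all of its reconstructions. $\operatorname{pr}_i^{(n)} \colon A^n \to A$ is the projection $\mathbf{a} \mapsto a_i$, $\mathcal{P}(A)$ is the power set of $A$,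 and $\operatorname{supp}(a_1,\dots,a_n) := \{a_1,\dots,a_n\}$. A function $f \colon A^n \to B$ is determined by $(\operatorname{pr}, \operatorname{supp})$ if there exist a map $f^* \colon A \times \mathcal{P}(A) \to B$ and $i \in [n]$ such that $f(\mathbf{a}) = f^*(\operatorname{pr}_i^{(n)}(\mathbf{a}), \operatorname{supp}(\mathbf{a}))$ for all $\mathbf{a} \in A^n$. *)

(* Defs.v *)
From mathcomp Require Import all_boot fingroup perm.
From mathcomp Require Import finmap multiset.
From mathcomp Require Import boolp classical_sets.

Set Implicit Arguments.
Unset Strict Implicit.
Unset Printing Implicit Defensive.

Local Open Scope nat_scope.

(* The index set [n] = {1, ..., n} is 'I_n = {0, ..., n-1}, so that positions
   are shifted by one, and A^n is n.-tuple A. *)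

Definition reindex (A : Type) (m n : nat) (s : 'I_m -> 'I_n)
  (a : n.-tuple A) : m.-tuple A := [tuple tnth a (s i) | i < m].

Definition fequiv (A B : Type) (n : nat) (f g : n.-tuple A -> B) : Prop :=
  exists s : 'S_n, forall a : n.-tuple A, f a = g (reindex s a).

Definition pair_of (n : nat) : finType := {I : {set 'I_n} | #|I| == 2}.

Definition maxI (n : nat) (I : pair_of n) : nat := \max_(i in val I) i.

(* The default value n is never reached, since I is nonempty. *)
Definition minI (n : nat) (I : pair_of n) : nat := \big[minn/n]_(i in val I) i.

Definition delta_nat (n : nat) (I : pair_of n) (i : nat) : nat :=
  if i < maxI I then i else if i == maxI I then minI I else i.-1.

Lemma pair_ofP (n : nat) (I : pair_of n) :
  exists i j : 'I_n, [/\ val I = [set i; j]%SET, i < j, minI I = i & maxI I = j].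
Proof.
have [x [y [xy defI]]] : exists x y : 'I_n, x < y /\ val I = [set x; y]%SET.
  have /cards2P [x [y [xy defI]]] : #|val I| == 2 := valP I.
  have [lt_xy|lt_yx|/val_inj eq_xy] := ltngtP x y.
  - by exists x, y.
  - by exists y, x; rewrite finset.setUC.
  - by case/eqP: xy.
have xI : x \in val I by rewrite defI !inE eqxx.
have yI : y \in val I by rewrite defI !inE eqxx orbT.
exists x, y; split=> //; apply/eqP; rewrite eqn_leq; apply/andP; split.
- have: x \in index_enum 'I_n by rewrite mem_index_enum.
  rewrite /minI; elim: (index_enum _) => // z s IHs; rewrite inE big_cons.
  case/predU1P => [<-|/IHs le_s]; first by rewrite xI geq_minl.
  by case: ifP => // _; rewrite geq_min le_s orbT.
- apply: (big_ind (fun m => x <= m)) => [|m p xm xp|z].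
  + exact: ltnW.
  + by rewrite leq_min xm.
  + by rewrite defI !inE => /orP[] /eqP -> //; apply: ltnW.
- apply/bigmax_leqP => z.
  by rewrite defI !inE => /orP[] /eqP -> //; apply: ltnW.
- exact: leq_bigmax_cond.
Qed.

Lemma delta_lt (n : nat) (I : pair_of n) (i : 'I_n) : delta_nat I i < n.-1.
Proof.
have [x [y [_ xy minE maxE]]] := pair_ofP I.
have n_gt0 : 0 < n by apply: leq_ltn_trans (ltn_ord i).
have leP m : (m <= n.-1) = (m < n) by rewrite -{2}(prednK n_gt0) ltnS.
rewrite /delta_nat minE maxE; have [iy|yi|_] := ltngtP i y; rewrite leP.
- exact: leq_ltn_trans iy (ltn_ord y).
- by rewrite prednK ?(leq_ltn_trans _ yi).
- exact: leq_ltn_trans xy (ltn_ord y).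
Qed.

Definition delta (n : nat) (I : pair_of n) (i : 'I_n) : 'I_n.-1 :=
  Ordinal (delta_lt I i).

Definition minor (A B : Type) (n : nat) (f : n.-tuple A -> B) (I : pair_of n) :
  n.-1.-tuple A -> B := fun a => f (reindex (delta I) a).

Definition fclass (A B : Type) (n : nat) (f : n.-tuple A -> B) :
  set (n.-tuple A -> B) := fequiv f.

Lemma fclass_eq (A B : Type) (n : nat) (f g : n.-tuple A -> B) :
  fclass f = fclass g <-> fequiv f g.
Proof.
have reindexM (s t : 'S_n) (a : n.-tuple A) :
    reindex s (reindex t a) = reindex (s * t)%g a.
  by apply: eq_from_tnth => i; rewrite !tnth_mktuple permM.
have reindex1 (a : n.-tuple A) : reindex (1%g : 'S_n) a = a.
  by apply: eq_from_tnth => i; rewrite tnth_mktuple perm1.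
have refl (h : n.-tuple A -> B) : fequiv h h by exists 1%g => a; rewrite reindex1.
have sym (h k : n.-tuple A -> B) : fequiv h k -> fequiv k h.
  move=> [s hk]; exists s^-1%g => a; rewrite hk reindexM.
  by rewrite mulgV reindex1.
have trans (h k l : n.-tuple A -> B) : fequiv h k -> fequiv k l -> fequiv h l.
  by move=> [s hk] [t kl]; exists (t * s)%g => a; rewrite hk kl reindexM.
split=> [eq_fg|fg].
  have: fclass g g by apply: refl.
  by rewrite -eq_fg.
apply/funext => h; apply/propext.
by split=> ?; [apply: trans (sym _ _ fg) _ | apply: trans fg _].
Qed.

Definition deck (A B : Type) (n : nat) (f : n.-tuple A -> B) :
  {mset set (n.-1.-tuple A -> B)}%mset :=
  seq_mset [seq fclass (minor f J) | J : pair_of n].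

Definition reconstruction_of (A B : Type) (n : nat) (g f : n.-tuple A -> B) :
  Prop := deck f = deck g.

Definition reconstructible (A B : Type) (n : nat) (f : n.-tuple A -> B) : Prop :=
  forall g : n.-tuple A -> B, reconstruction_of g f -> fequiv f g.

Definition supp (A : finType) (n : nat) (a : n.-tuple A) : {set A} :=
  [set x | x \in a]%SET.

Definition determined_by_pr_supp (A : finType) (B : Type) (n : nat)
  (f : n.-tuple A -> B) : Prop :=
  exists (fstar : A * {set A} -> B) (i : 'I_n),
    forall a : n.-tuple A, f a = fstar (tnth a i, supp a).

(* Main.v *)
(** Every identification minor of [f] is again of the form
    [a |-> fstar (a_j, supp a)] for the same [fstar].  Hence a reconstruction
    [g] of [f] satisfies, for each pair [p <> q], [g c = fstar (c_t, supp c)]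
    on all tuples [c] with [c_p = c_q], for some [t] depending on [p, q].  If
    [fstar] depends on its first argument, then, since merging two pairs of
    positions leaves at least [n - 2 >= #|A|] positions, the values of [t]
    attached to two pairs agree up to these mergings; as [n >= 4], this forces
    a common [t] for all pairs.  Every tuple has a repetition, so [g] is
    determined by [fstar] and position [t]. *)

From Pilot Require Import Defs.
From mathcomp Require Import all_boot.
From mathcomp Require Import perm multiset boolp.
(* [reindex] must denote the one of [Defs], not the lemma of [bigop]. *)
Import Pilot.Defs.

Set Implicit Arguments.
Unset Strict Implicit.
Unset Printing Implicit Defensive.

Local Open Scope nat_scope.

(** A right inverse makes [s] surjective, so reindexing loses no entry. *)
Lemma supp_reindex (A : finType) (m n : nat) (s : 'I_m -> 'I_n)
    (s' : 'I_n -> 'I_m) (a : n.-tuple A) :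
  cancel s' s -> supp (reindex s a) = supp a.
Proof.
move=> s'K; apply/setP => x; rewrite !inE; apply/tnthP/tnthP => -[i ->].
  by exists (s i); rewrite tnth_mktuple.
by exists (s' i); rewrite tnth_mktuple s'K.
Qed.

(** The section is [lift q], which skips [q]; through it, a tuple with equal entries at [p] and [q]
    factors through [delta J]. *)
Lemma delta_section (n : nat) (J : pair_of n) :
  exists (p q : 'I_n) (s : 'I_n.-1 -> 'I_n),
    [/\ p < q, val J = [set p; q]%SET, cancel s (delta J) &
        forall i, s (delta J i) = if i == q then p else i].
Proof.
have [p [q [defJ pq minE maxE]]] := pair_ofP J.
exists p, q, (lift q); split=> // i.
  apply/val_inj; rewrite /= /delta_nat maxE minE /bump.
  by case: (leqP q i) => /= hi; rewrite ?add1n ?add0n ?hi // ltnNge leqW //= gtn_eqF.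
apply/val_inj; rewrite /= /delta_nat maxE minE /bump -val_eqE /=.
have [iq|qi|iq] := ltngtP i q.
- by rewrite leqNgt iq.
- by rewrite -ltnS (ltn_predK qi) qi add1n (ltn_predK qi).
- by rewrite leqNgt pq.
Qed.

Lemma two_outside (T : finType) (a b : T) : 4 <= #|T| ->
  exists u v, [/\ u != v, u \notin [:: a; b] & v \notin [:: a; b]].
Proof.
move=> T4; have /card_gt1P [u [v [+ + uv]]] : 1 < #|~: [set a; b]%SET|.
  rewrite cardsCs finset.setCK cards2; apply: leq_trans (leq_sub2r _ T4).
  by case: (a != b).
by rewrite !inE => hu hv; exists u, v; rewrite !inE.
Qed.

Lemma separating_surjection (T A : finType) (D : {set T}) (S : {set A})
    (u v : T) (x y : A) :
  u != v -> u \in D -> v \in D -> x != y -> x \in S -> y \in S ->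
  #|S| <= #|D| -> exists e : T -> A, [/\ e u = x, e v = y & e @: D = S].
Proof.
move=> uv uD vD xy xS yS leSD.
pose D' := D :\ u :\ v; pose S' := S :\ x :\ y.
have leSD' : #|S'| <= #|D'|.
  have := leSD; rewrite (cardsD1 u D) uD (cardsD1 v (D :\ u)) !inE eq_sym uv vD.
  by rewrite (cardsD1 x S) xS (cardsD1 y (S :\ x)) !inE eq_sym xy yS.
(* The rest of [D] runs through the enumeration of [S']; surplus elements get the default [x], which
   lies in [S]. *)
pose e i := if i == u then x else if i == v then y else
  nth x (enum S') (index i (enum D')).
have eu : e u = x by rewrite /e eqxx.
have ev : e v = y by rewrite /e eq_sym (negbTE uv) eqxx.
exists e; split=> //; apply/setP => z; apply/imsetP/idP => [[i iD ->]|zS].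
  rewrite /e; case: eqP => // _; case: eqP => // _.
  have [lt|ge] := ltnP (index i (enum D')) (size (enum S')).
    by have := mem_nth x lt; rewrite mem_enum !inE => /and3P[].
  by rewrite nth_default.
have [->|zx] := eqVneq z x; first by exists u.
have [->|zy] := eqVneq z y; first by exists v.
have zS' : z \in enum S' by rewrite mem_enum !inE zx zy.
have lt : index z (enum S') < size (enum D').
  by rewrite -cardE (leq_trans _ leSD') // cardE index_mem.
have := mem_nth u lt; set i := nth _ _ _; rewrite mem_enum !inE.
case/and3P => /negbTE iv /negbTE iu iD; exists i => //.
by rewrite /e iu iv index_uniq ?enum_uniq ?nth_index.
Qed.

Section CommonPosition.

Context {A : finType} {B : Type} {n : nat}.
Variables (F : A * {set A} -> B) (g : n.-tuple A -> B).

Definition reads_at (p q t : 'I_n) : Prop :=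
  forall c : n.-tuple A, tnth c p = tnth c q -> g c = F (tnth c t, supp c).

Definition merge (p q i : 'I_n) : 'I_n := if i == q then p else i.

Lemma merge_eq (p q : 'I_n) : merge p q p = merge p q q.
Proof. by rewrite /merge eqxx; case: ifP. Qed.

(** Its fibres are the classes of the equivalence generated by p ~ q and p' ~ q'; carrying the
    second pair through the first merging covers overlapping pairs. *)
Definition merge2 (p q p' q' i : 'I_n) : 'I_n :=
  merge (merge p q p') (merge p q q') (merge p q i).

(** Every position other than [q] and [merge p q q'] is its own image. *)
Lemma card_merge2 (p q p' q' : 'I_n) :
  n - 2 <= #|[set merge2 p q p' q' i | i in 'I_n]|.
Proof.
apply: leq_trans (_ : #|~: [set q; merge p q q']%SET| <= _).
  rewrite cardsCs finset.setCK card_ord leq_sub2l // cards2.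
  by case: (_ != _).
apply/subset_leq_card/fintype.subsetP => i; rewrite !inE => /norP[iq iq'].
by apply/imsetP; exists i; rewrite // /merge2 {4}/merge (negbTE iq) /merge (negbTE iq').
Qed.

Hypothesis n_large : #|A| + 2 <= n.
Hypothesis F_dep : exists (S : {set A}) x y,
  [/\ x \in S, y \in S & F (x, S) <> F (y, S)].

(** If [t] and [t'] lay in different classes, some tuple constant on classes would have support [S],
    with x at [t] and y at [t'], since there are at least n - 2 >= |A| classes. Both descriptions of
    [g] would apply to it, giving F (x, S) = F (y, S). *)
Lemma reads_at_compat (p q p' q' t t' : 'I_n) :
  reads_at p q t -> reads_at p' q' t' ->
  merge2 p q p' q' t = merge2 p q p' q' t'.
Proof.
case: F_dep => S [x [y [xS yS Fxy]]] Pt Pt'; apply/eqP; case: eqVneq => // rtt'.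
have xy : x != y by apply/eqP => exy; apply: Fxy; rewrite exy.
set r := merge2 p q p' q' in rtt'.
have leS : #|S| <= #|[set r i | i in 'I_n]|.
  apply: leq_trans (card_merge2 p q p' q'); apply: leq_trans (max_card _) _.
  by rewrite leq_subRL ?(leq_trans _ n_large) ?leq_addl // addnC.
have [||e [ex ey eS]] := separating_surjection rtt' _ _ xy xS yS leS.
- exact: imset_f.
- exact: imset_f.
pose c := [tuple e (r i) | i < n].
have suppc : supp c = S.
  rewrite -eS; apply/setP => z; rewrite inE; apply/tnthP/imsetP.
    by case=> i ->; rewrite tnth_mktuple; exists (r i) => //; apply: imset_f.
  by case=> _ /imsetP[i _ ->] ->; exists i; rewrite tnth_mktuple.
case: Fxy; rewrite -suppc -ex -ey -[e (r t)](tnth_mktuple (e \o r)).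
rewrite -[e (r t')](tnth_mktuple (e \o r)) -Pt ?Pt' // !tnth_mktuple /r.
  by rewrite /= /merge2 merge_eq.
by rewrite /= /merge2 merge_eq.
Qed.

Lemma common_position :
  (forall p q, p != q -> exists t, reads_at p q t) ->
  exists t, forall p q, p != q -> reads_at p q t.
Proof.
move=> reads.
have n4 : 4 <= #|'I_n|.
  case: F_dep => S [x [y [_ _ Fxy]]]; rewrite card_ord; apply: leq_trans n_large.
  rewrite -[4]/(2 + 2) leq_add2r; apply/card_gt1P; exists x, y; split=> //.
  by apply/eqP => exy; apply: Fxy; rewrite exy.
(* Of two disjoint pairs, one has its position outside itself: otherwise [t] and [t'] would lie in
   the distinct classes {p, q} and {u, v}. *)
have [p [q [t [pq tp tq Pt]]]] :
    exists p q t, [/\ p != q, t != p, t != q & reads_at p q t].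
  have /card_gt0P[i _] : 0 < #|'I_n| by apply: leq_trans n4.
  have [p [q [pq _ _]]] := two_outside i i n4.
  have [u [v [uv]]] := two_outside p q n4.
  rewrite !inE => /norP[up uq] /norP[vp vq].
  have [t Pt] := reads p q pq; have [t' Pt'] := reads u v uv.
  have [|/norP[tp tq]] := boolP ((t == p) || (t == q)); last by exists p, q, t.
  have [|/norP[tu tv]] := boolP ((t' == u) || (t' == v)); last by exists u, v, t'.
  move=> ht' ht; have := reads_at_compat Pt Pt'.
  rewrite /merge2 /merge (negbTE uq) (negbTE vq).
  have -> : (if t == q then p else t) = p.
    by move: ht; case: (t == q); rewrite ?orbF // => /eqP.
  rewrite [p == v]eq_sym (negbTE vp).
  have [->|t'v] := eqVneq t' v; last first.
    move: ht'; rewrite (negbTE t'v) orbF => /eqP ->.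
    by rewrite (negbTE uq) (negbTE uv) => epu; rewrite epu eqxx in up.
  by rewrite (negbTE vq) eqxx => epu; rewrite epu eqxx in up.
exists t.
(* The class of [t] under both mergings is {t}, which forces t' = t. *)
have away u v : u != v -> t != u -> t != v -> reads_at u v t.
  move=> uv tu tv; have [t' Pt'] := reads u v uv.
  have := reads_at_compat Pt Pt'.
  suff -> : merge2 p q u v t = t.
    rewrite /merge2 /merge; case: (eqVneq t' q) => _.
      case: eqP => _ ett; last by rewrite ett eqxx in tp.
      by case: (u == q) ett => ett; rewrite ett eqxx in tp tu.
    case: eqP => _ ett; last by rewrite ett.
    by case: (u == q) ett => ett; rewrite ett eqxx in tp tu.
  rewrite /merge2 /merge (negbTE tq).
  by case: (v == q); rewrite ?(negbTE tp) ?(negbTE tv).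
(* Compare with a pair {a, b} disjoint from {t, v}: [t'] must be [t] or [v], and the tuples
   concerned have equal entries there. *)
have touching v : t != v -> reads_at t v t.
  move=> tv; have [t' Pt'] := reads t v tv.
  have [a [b [ab]]] := two_outside t v n4.
  rewrite !inE => /norP[a_t av] /norP[bt bv].
  have Pab : reads_at a b t by apply: away; rewrite // eq_sym.
  have := reads_at_compat Pab Pt'.
  rewrite /merge2 /merge [t == b]eq_sym (negbTE bt) [v == b]eq_sym (negbTE bv).
  rewrite (negbTE tv); have [_|t'b] := eqVneq t' b.
    by rewrite (negbTE av) => ett; rewrite ett eqxx in a_t.
  have [et' _ c ec|_ ett'] := eqVneq t' v; last by rewrite {2}ett'.
  by rewrite Pt' // et' ec.
move=> u v uv; have [etu|tu] := eqVneq t u.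
  by rewrite -etu; apply: touching; rewrite etu.
have [etv c ec|tv] := eqVneq t v; last exact: away.
by apply: (touching u); rewrite ?etv // eq_sym.
Qed.

End CommonPosition.

Lemma reads_at_minor (A : finType) (B : Type) (n : nat)
    (F : A * {set A} -> B) (i : 'I_n) (f g : n.-tuple A -> B) :
  (forall a, f a = F (tnth a i, supp a)) -> reconstruction_of g f ->
  forall p q, p != q -> exists t, reads_at F g p q t.
Proof.
move=> fE eq_deck.
suff reads (p q : 'I_n) : p < q -> exists t, reads_at F g p q t.
  move=> p q; rewrite -val_eqE /= neq_ltn => /orP[/reads //|/reads[t Pt]].
  by exists t => c /esym; apply: Pt.
move=> pq; have cardJ : #|[set p; q]%SET| == 2.
  by rewrite cards2; have [epq|//] := eqVneq p q; move: pq; rewrite epq ltnn.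
have [x [y [s [xy /setP defJ sK dK]]]] :=
  delta_section (exist _ [set p; q]%SET cardJ : pair_of n).
have [ex ey] : x = p /\ y = q.
  move: (defJ x) (defJ y) xy; rewrite !inE !eqxx orbT.
  by case/orP=> /eqP -> /orP[] /eqP -> //; rewrite ?ltnn // ltnNge ltnW.
rewrite ex ey in dK; set J := exist _ _ _ in sK dK.
have : fclass (minor g J) \in deck g.
  by rewrite /deck (perm_mem (perm_eq_seq_mset _)); apply: map_f; rewrite mem_enum.
rewrite -eq_deck /deck (perm_mem (perm_eq_seq_mset _)) => /mapP[J' _].
move/fclass_eq => [w gw].
(* Position [i] of [f], traced through [delta J'], the permutation [w] and the section [s]. *)
exists (s (w (delta J' i))) => c ec.
have cE : c = reindex (delta J) (reindex s c).
  apply: eq_from_tnth => j; rewrite !tnth_mktuple dK.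
  by case: eqP => [->|].
have [_ [_ [s' [_ _ s'K _]]]] := delta_section J'.
have suppc : supp (reindex s c) = supp c.
  by rewrite [in RHS]cE (supp_reindex _ sK).
rewrite {1}cE -[g _]/(minor g J _) gw /minor fE.
rewrite (supp_reindex _ s'K) -suppc.
rewrite (@supp_reindex _ _ _ w w^-1%g) => [|j]; last exact: permKV.
by rewrite !tnth_mktuple.
Qed.

Theorem theorem6p2 (A : finType) (B : Type) (k n : nat)
  (hA : 2 <= #|A|) (hB : exists b1 b2 : B, b1 <> b2)
  (hk0 : 0 < k) (hn0 : 0 < n)
  (hn : k + 2 <= n) (hk : #|A| = k)
  (f : n.-tuple A -> B) (hf : determined_by_pr_supp f) :
  reconstructible f.
Proof.
subst k => g eq_deck.
case: hf => fstar [i fE].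
have [t Pt] : exists t, forall p q, p != q -> reads_at fstar g p q t.
  have reads := reads_at_minor fE eq_deck.
  have [dep|indep] :=
    pselect (exists (S : {set A}) x y, [/\ x \in S, y \in S & fstar (x, S) <> fstar (y, S)]).
    exact: common_position hn dep reads.
  (* Here [fstar] is constant in its first argument within the support, so any position serves. *)
  exists i => p q /reads[t Pt] c ec; rewrite Pt //; apply: contrapT => Fne.
  by apply: indep; exists (supp c), (tnth c t), (tnth c i); rewrite !inE !mem_tnth.
have gE c : g c = fstar (tnth c t, supp c).
  (* Pigeonhole: there are more positions than values, so [c] has a repetition. *)
  have [/injectiveP/leq_card|/injectivePn[p [q pq ec]]] := boolP (injectiveb (tnth c)).
    by rewrite card_ord leqNgt (leq_trans _ hn) // addn2 ltnS leqW.
  exact: Pt ec.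
(* Swapping [i] and [t] turns reading at [t] into reading at [i]. *)
exists (tperm i t) => a.
rewrite fE gE tnth_mktuple tpermR (@supp_reindex _ _ _ _ (tperm i t)) // => j.
exact: tpermK.
Qed.
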